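(* Let $R=\prod_{i=1}^{q}R_i/N_iR_i$, where each $R_i$ is a principal ideal domain and $N_i\in R_i$ is not a unit (possibly $N_i=0$). Let $S=R[x_1,\dots,x_n]$ and let $M$ be a finitely generated $S$-module. Then there are an integer $p$ with $0\le p\le n+1$ and free $S$-modules $F_0,\dots,F_p$ of finite rank such that $M$ admits a free $S$-resolution $$\dots\to F_p\to F_p\to F_p\to F_{p-1}\to\dots\to F_1\to F_0\to M\to 0,$$ that is, an exact sequence in which the module in every homological degree $\ge p$ is $F_p$ (the maps may vary). *)

(* Defs.v *)
From HB Require Import structures.
From mathcomp Require Import all_boot all_order all_algebra.
From mathcomp Require Import boolp.
From mathcomp Require Import mpoly.

Set Implicit Arguments.
Unset Strict Implicit.
Unset Printing Implicit Defensive.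

Import GRing.Theory.
Local Open Scope ring_scope.

(* Ideals are Prop-valued sets, so that no decidability is imposed on them. *)
Definition is_ideal (A : comNzRingType) (I : A -> Prop) : Prop :=
  [/\ I 0,
      forall x y, I x -> I y -> I (x + y)
    & forall a x, I x -> I (a * x)].

Definition is_PID (A : idomainType) : Prop :=
  forall I : A -> Prop, is_ideal I ->
    exists g : A, forall x, I x <-> exists a, x = g * a.

(* The principal ideal N A, as a boolean predicate; the proof that N is not a
   unit is an argument so that the ideal is canonically proper, as required by
   the quotient construction {ideal_quot _}. *)
Definition pideal (A : idomainType) (N : A) (_ : N \isn't a GRing.unit) :
  {pred A} := [pred x | `[< exists a, x = N * a >] ].

Section PrincipalIdeal.
Variables (A : idomainType) (N : A) (hN : N \isn't a GRing.unit).

Lemma pidealP x : reflect (exists a, x = N * a) (x \in pideal hN).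
Proof. exact: asboolP. Qed.

Lemma pideal_idealr_closed : idealr_closed (pideal hN).
Proof.
split.
- by apply/pidealP; exists 0; rewrite mulr0.
- apply/negP => /pidealP[a e]; case/negP: hN.
  by apply/unitrP; exists a; rewrite mulrC -e.
- move=> a u v /pidealP[b ->] /pidealP[c ->]; apply/pidealP.
  by exists (a * b + c); rewrite mulrDr mulrCA.
Qed.

HB.instance Definition _ := isIdealr.Build A (pideal hN) pideal_idealr_closed.
End PrincipalIdeal.

Definition quot_by (A : idomainType) (N : A) (hN : N \isn't a GRing.unit) :
  comNzRingType := {ideal_quot (pideal hN)}.

(* The product of the rings T 0, ..., T q. There is at least one factor, since
   the polynomial ring {mpoly R[n]} requires 1 != 0 in R. *)
Definition prod_ring (q : nat) (T : 'I_q.+1 -> comNzRingType) : Type :=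
  {dffun forall i : 'I_q.+1, T i}.

Section ProductRing.
Variables (q : nat) (T : 'I_q.+1 -> comNzRingType).
Local Notation P := (prod_ring T).
Implicit Types x y z : P.

HB.instance Definition _ := Choice.on P.

Definition prod_zero : P := [ffun i => 0 : T i].
Definition prod_one : P := [ffun i => 1 : T i].
Definition prod_opp x : P := [ffun i => - x i : T i].
Definition prod_add x y : P := [ffun i => x i + y i : T i].
Definition prod_mul x y : P := [ffun i => x i * y i : T i].

Fact prod_addA : associative prod_add.
Proof. by move=> x y z; apply/ffunP => i; rewrite !ffunE addrA. Qed.
Fact prod_addC : commutative prod_add.
Proof. by move=> x y; apply/ffunP => i; rewrite !ffunE addrC. Qed.
Fact prod_add0 : left_id prod_zero prod_add.
Proof. by move=> x; apply/ffunP => i; rewrite !ffunE add0r. Qed.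
Fact prod_addN : left_inverse prod_zero prod_opp prod_add.
Proof. by move=> x; apply/ffunP => i; rewrite !ffunE addNr. Qed.

HB.instance Definition _ :=
  GRing.isZmodule.Build P prod_addA prod_addC prod_add0 prod_addN.

Fact prod_mulA : associative prod_mul.
Proof. by move=> x y z; apply/ffunP => i; rewrite !ffunE mulrA. Qed.
Fact prod_mulC : commutative prod_mul.
Proof. by move=> x y; apply/ffunP => i; rewrite !ffunE mulrC. Qed.
Fact prod_mul1 : left_id prod_one prod_mul.
Proof. by move=> x; apply/ffunP => i; rewrite !ffunE mul1r. Qed.
Fact prod_mulD : left_distributive prod_mul prod_add.
Proof. by move=> x y z; apply/ffunP => i; rewrite !ffunE mulrDl. Qed.
Fact prod_one_neq0 : prod_one != 0.
Proof.
by apply/eqP => /ffunP/(_ ord0)/eqP; rewrite !ffunE oner_eq0.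
Qed.

HB.instance Definition _ := GRing.Zmodule_isComNzRing.Build P
  prod_mulA prod_mulC prod_mul1 prod_mulD prod_one_neq0.
End ProductRing.

Definition finitely_generated (S : nzRingType) (M : lmodType S) : Prop :=
  exists (k : nat) (g : 'I_k -> M),
    forall m : M, exists c : 'I_k -> S, m = \sum_(i < k) c i *: g i.

Definition exact_at (S : nzRingType) (U V W : lmodType S)
    (f : {linear U -> V}) (g : {linear V -> W}) : Prop :=
  forall v : V, g v = 0 <-> exists u : U, f u = v.

(* Exactness of ... -> C 2 -> C 1 -> C 0 -> M -> 0, with d i : C i.+1 -> C i. *)
Definition is_resolution (S : nzRingType) (M : lmodType S)
    (C : nat -> lmodType S) (d : forall i : nat, {linear C i.+1 -> C i})
    (eps : {linear C 0%N -> M}) : Prop :=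
  [/\ forall m : M, exists u : C 0%N, eps u = m,
      exact_at (d 0%N) eps
    & forall i : nat, exact_at (d i.+1) (d i)].

(* The sequence F 0, ..., F p.-1, F p, F p, F p, ...  Over a ring S, the
   library's vectType S is the type of S-modules equipped with a linear
   isomorphism to some 'rV[S]_r, i.e. of free modules of finite rank. *)
Definition stationary_from (S : nzRingType) (p : nat) (F : nat -> vectType S) :
  nat -> lmodType S := fun i => F (minn i p).

(* Main.v *)
Require Import Defs.
From HB Require Import structures.
From mathcomp Require Import all_boot all_order all_algebra.
From mathcomp Require Import boolp.
From mathcomp Require Import mpoly.

Set Implicit Arguments.
Unset Strict Implicit.
Unset Printing Implicit Defensive.

Import GRing.Theory.
Local Open Scope ring_scope.

(** The ring R is a principal ideal ring: an ideal of a finite product is the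
    product of its projections, and an ideal of a quotient of a PID lifts to
    the PID. Over such a ring every submodule of R^k is generated by k elements
    ([PIR_submodule_gen]). So, if M has k generators, its relations need only k
    generators, the relations between these need only k, and so on: M has a
    free resolution whose ranks are all k ([PIR_resolvable]). This is the case
    n = 0.

    Adding a variable X to a Noetherian ring A delays by one the degree from
    which the ranks are constant ([resolvable_poly]). Let Y be an A[X]-module
    with a finite system g of generators and let M_j be the A-module generated
    by the X^i g_l with i < j. For all j there is a complex
      0 -> A[X] (x) M_j -> A[X] (x) M_(j+1) -> Y -> 0
    in which the first map sends f (x) m to X f (x) m - f (x) X m. It is exact
    as soon as j is so large that all relations between the g_l follow from
    those of degree at most j, because then an element of the kernel of
    evaluation can be lowered in degree step by step; such a j exists since the
    leading coefficients of relations form an ascending chain of submodules of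
    A^k ([relations_generated_in_low_degree]). As M_j and M_(j+1) are finitely
    generated over A, they have resolutions with ranks constant from degree p
    on. These extend to A[X] by flatness, the first map lifts to the extended
    resolutions, and its mapping cone is a resolution of Y
    ([resolution_by_cone]). Its rank in degree i+1 is the sum of a rank in
    degree i+1 and a rank in degree i, hence is constant from degree p+1 on.

    With n variables, and with Hilbert's basis theorem to preserve
    Noetherianity, the ranks are constant from degree n on. *)

(** * Ascending chains of ideals *)

Definition ascending (T : Type) (U : nat -> T -> Prop) : Prop :=
  forall j x, U j x -> U j.+1 x.

Definition stops (T : Type) (U : nat -> T -> Prop) : Prop :=
  exists N, forall j x, U j x -> U N x.

(** The ascending chain condition is used rather than finite generation because
    it passes to polynomials and to submodules of A^k without ever choosing
    generators. *)
Definition noetherian (A : comNzRingType) : Prop :=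
  forall I : nat -> A -> Prop,
    (forall j, is_ideal (I j)) -> ascending I -> stops I.

Definition is_PIR (A : comNzRingType) : Prop :=
  forall I : A -> Prop, is_ideal I ->
    exists g : A, forall x, I x <-> exists a, x = g * a.

Lemma ascending_le (T : Type) (U : nat -> T -> Prop) :
  ascending U -> forall i j x, (i <= j)%N -> U i x -> U j x.
Proof.
by move=> aU i j x /subnK<- Ux; elim: (j - i)%N => // k IHk; apply: aU.
Qed.

Lemma PIR_noetherian (A : comNzRingType) : is_PIR A -> noetherian A.
Proof.
move=> pirA I idI aI.
have leI := ascending_le aI.
have [|g Ig] := pirA (fun x => exists j, I j x).
  split; first by exists 0%N; case: (idI 0%N).
    move=> x y [i Ix] [j Iy]; exists (maxn i j).
    by case: (idI (maxn i j)) => _ addI _; apply: addI;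
      [apply: leI Ix; apply: leq_maxl | apply: leI Iy; apply: leq_maxr].
  by move=> a x [j Ix]; exists j; case: (idI j) => _ _; apply.
have [N IN] : exists N, I N g by apply/Ig; exists 1; rewrite mulr1.
exists N => j x Ix.
have [a ->] : exists a, x = g * a by apply/Ig; exists j.
by rewrite mulrC; case: (idI N) => _ _; apply.
Qed.

Section Submodules.
Variables (A : comNzRingType) (L : lmodType A).

Definition submodule (U : L -> Prop) : Prop :=
  [/\ U 0, forall x y, U x -> U y -> U (x + y)
    & forall a x, U x -> U (a *: x)].

Lemma submoduleB (U : L -> Prop) x y : submodule U -> U x -> U y -> U (x - y).
Proof. by case=> _ aU sU Ux Uy; apply: aU => //; rewrite -scaleN1r; apply: sU. Qed.

Lemma submodule_sum (U : L -> Prop) I (r : seq I) (P : pred I) (F : I -> L) :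
  submodule U -> (forall i, P i -> U (F i)) -> U (\sum_(i <- r | P i) F i).
Proof. by case=> U0 aU _ UF; apply: big_ind. Qed.
End Submodules.

(** The ideal of first coordinates of a submodule of A^(1+k), and the submodule
    of A^k of its elements with first coordinate 0: the two pieces on which
    statements about submodules of free modules are proved by induction on
    the rank. *)
Section Devissage.
Variables (A : comNzRingType) (k : nat) (U : 'rV[A]_(1 + k) -> Prop).
Hypothesis subU : submodule U.

Definition firsts (a : A) : Prop := exists2 v, U v & v 0 0 = a.
Definition tails (w : 'rV[A]_k) : Prop := U (row_mx 0 w).

Lemma firsts_ideal : is_ideal firsts.
Proof.
case: subU => U0 aU sU; split; first by exists 0; rewrite ?mxE.
  by move=> _ _ [v Uv <-] [w Uw <-]; exists (v + w); rewrite ?mxE //; apply: aU.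
by move=> a _ [v Uv <-]; exists (a *: v); rewrite ?mxE //; apply: sU.
Qed.

Lemma tails_submodule : submodule tails.
Proof.
case: subU => U0 aU sU; split; rewrite /tails ?row_mx0 //.
  by move=> v w Uv Uw; rewrite -[0]addr0 -add_row_mx; apply: aU.
by move=> a v Uv; rewrite -[0](scaler0 _ a) -scale_row_mx; apply: sU.
Qed.

Lemma tailE (v : 'rV[A]_(1 + k)) : v 0 0 = 0 -> row_mx 0 (rsubmx v) = v.
Proof.
move=> v0; rewrite -[RHS]hsubmxK; congr row_mx.
by apply/rowP => i; rewrite ord1 !mxE -[LHS]v0; congr (v _ _); apply/val_inj.
Qed.
End Devissage.

(** A submodule of A^(1+k) is determined, among those that contain it, by its
    first coordinates and its tails: if both chains are stationary then so is
    the chain of submodules. *)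
Lemma noetherian_rV (A : comNzRingType) (k : nat) (U : nat -> 'rV[A]_k -> Prop) :
  noetherian A -> (forall j, submodule (U j)) -> ascending U -> stops U.
Proof.
move=> noeA; elim: k => [|k IHk] in U * => subU aU.
  by exists 0%N => j x _; rewrite (thinmx0 x); case: (subU 0%N).
change (nat -> 'rV[A]_(1 + k) -> Prop) in U.
have [|j a [v Uv va]|n1 Un1] := noeA (fun j => firsts (U j)).
- by move=> j; apply: firsts_ideal.
- by exists v => //; apply: aU.
have [|j w|n2 Un2] := IHk (fun j => tails (U j)).
- by move=> j; apply: tails_submodule.
- exact: aU.
exists (maxn n1 n2) => j v Uv.
have [v' Uv' v'E] : firsts (U n1) (v 0 0) by apply: (Un1 j); exists v.
have leU := ascending_le aU.
have Ub : U (maxn n1 n2) (v - v').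
  apply: (leU _ _ _ (leq_maxr _ _)); rewrite -(@tailE _ _ (v - v')); last first.
    by rewrite !mxE v'E subrr.
  apply: (Un2 (maxn j n1)); rewrite /tails tailE; last by rewrite !mxE v'E subrr.
  by apply: submoduleB => //; [apply: leU (leq_maxl _ _) _ | apply: leU (leq_maxr _ _) _].
rewrite -[v](subrK v'); case: (subU (maxn n1 n2)) => _ + _; apply => //.
exact: leU (leq_maxl _ _) _.
Qed.

(** One generator is spent on a preimage of the generator of the ideal of first
    coordinates, and the k others generate the tails. *)
Lemma PIR_submodule_gen (A : comNzRingType) (k : nat) (U : 'rV[A]_k -> Prop) :
  is_PIR A -> submodule U ->
  exists D : 'M[A]_k, forall v, U v <-> exists w, v = w *m D.
Proof.
move=> pirA; elim: k => [|k IHk] in U * => subU.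
  exists 0 => v; split=> _; first by exists 0; rewrite (thinmx0 v) mulmx0.
  by rewrite (thinmx0 v); case: subU.
change ('rV[A]_(1 + k) -> Prop) in U.
have [g gP] := pirA _ (firsts_ideal subU).
have [D DP] := IHk _ (tails_submodule subU).
have [v0 Uv0 v0E] : firsts U g by apply/gP; exists 1; rewrite mulr1.
case: (subU) => U0 aU sU.
pose E : 'M[A]_(1 + k) := col_mx v0 (row_mx 0 D).
have mulE (w : 'rV[A]_(1 + k)) : w *m E = w 0 0 *: v0 + row_mx 0 (rsubmx w *m D).
  rewrite -{1}[w]hsubmxK mul_row_col mul_mx_row mulmx0.
  rewrite [lsubmx w]mx11_scalar mul_scalar_mx !mxE.
  by congr (w _ _ *: _ + _); apply/val_inj.
suff UE (v : 'rV[A]_(1 + k)) : U v <-> exists w : 'rV_(1 + k), v = w *m E.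
  by exists E => v; apply: UE.
split=> [Uv | [w ->]]; last first.
  rewrite mulE; apply: aU; first exact: sU.
  by apply/DP; exists (rsubmx w).
have [a va] : exists a, v 0 0 = g * a by apply/gP; exists v.
pose u := v - a *: v0.
have u0 : u 0 0 = 0 by rewrite !mxE v0E va mulrC subrr.
have [w wE] : exists w, rsubmx u = w *m D.
  by apply/DP; rewrite /tails tailE //; apply: submoduleB => //; apply: sU.
exists (row_mx a%:M w); rewrite mulE row_mxKr -wE tailE //.
have -> : (row_mx a%:M w : 'rV_(1 + k)) 0 0 = a.
  have -> : 0 = lshift k 0 :> 'I_(1 + k) by apply/val_inj.
  by rewrite row_mxEl mxE.
by rewrite addrC subrK.
Qed.

(** * Hilbert's basis theorem *)

Section Hilbert.
Variable A : comNzRingType.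
Implicit Types (I : {poly A} -> Prop) (f : {poly A}).

Definition lead_ideal I (d : nat) (a : A) : Prop :=
  exists2 f, I f & (size f <= d.+1)%N /\ f`_d = a.

Lemma lead_ideal_ideal I d : is_ideal I -> is_ideal (lead_ideal I d).
Proof.
case=> I0 aI sI; split; first by exists 0; rewrite ?size_poly0 ?coef0.
  move=> _ _ [f If [sf <-]] [g Ig [sg <-]]; exists (f + g); first exact: aI.
  rewrite coefD; split=> //; apply: leq_trans (size_polyD _ _) _.
  by rewrite geq_max sf sg.
move=> a _ [f If [sf <-]]; exists (a%:P * f); first exact: sI.
by rewrite coefCM mul_polyC (leq_trans (size_scale_leq _ _)).
Qed.

Lemma lead_ideal_asc I : is_ideal I -> ascending (lead_ideal I).
Proof.
case=> _ _ sI d _ [f If [sf <-]]; exists ('X * f); first exact: sI.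
rewrite coefXM /=; split=> //.
by have [->|f0] := eqVneq f 0; rewrite ?mulr0 ?size_poly0 // mulrC size_mulX.
Qed.

(** An ideal I of A[X] is determined, among those that contain it, by its
    leading ideals, so that it suffices to make all of them stationary at the
    same index. *)
Lemma noetherian_poly : noetherian A -> noetherian {poly A}.
Proof.
move=> noeA I idI aI.
have leI := ascending_le aI.
have leL d j j' a : (j <= j')%N -> lead_ideal (I j) d a -> lead_ideal (I j') d a.
  by move=> jj' [f If fE]; exists f => //; apply: (leI _ _ _ jj').
have leD j := ascending_le (lead_ideal_asc (idI j)).
have [||N NP] := noeA (fun d => lead_ideal (I d) d).
- by move=> d; apply: lead_ideal_ideal.
- by move=> d a La; apply: lead_ideal_asc => //; apply: leL La.
have [|M MP] := @choice _ _ (fun d M => forall j a,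
    lead_ideal (I j) d a -> lead_ideal (I M) d a).
  move=> d; apply: noeA => [j|j a]; first exact: lead_ideal_ideal.
  exact: leL.
(* Beyond N the leading ideals are constant in both the degree and the index,
   so only the finitely many degrees below N need their own index. *)
pose N' := maxn N (\max_(d < N) M d).
have key d j a : lead_ideal (I j) d a -> lead_ideal (I N') d a.
  case: (ltnP d N) => [dN|Nd] La.
    apply: leL (MP _ _ _ La); apply: leq_trans (leq_maxr _ _).
    exact: (leq_bigmax (Ordinal dN)).
  apply: (leD _ _ _ _ Nd); apply: (leL _ _ _ _ (leq_maxl _ _)).
  apply: (NP (maxn j d)); apply: (leD _ _ _ _ (leq_maxr _ _)).
  by apply: leL (leq_maxl _ _) La.
exists N' => j f; have [d] := ubnP (size f); elim: d => // d IHd in f *.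
rewrite ltnS => sf If.
case: d IHd sf => [_ sf|d IHd sf].
  by have /eqP-> : f == 0 by [rewrite -size_poly_leq0]; case: (idI N').
have [h Ih [sh hE]] : lead_ideal (I N') d f`_d.
  by apply: (key _ j); exists f.
rewrite -[f](subrK h); case: (idI N') => _ + _; apply=> //.
have subI i g1 g2 : I i g1 -> I i g2 -> I i (g1 - g2).
  by case: (idI i) => _ aIi sI g1I g2I; rewrite -mulN1r; apply: aIi => //; apply: sI.
have [jN|/ltnW Nj] := leqP j N'; first by apply: subI => //; apply: (leI _ _ _ jN).
apply: IHd; last by apply: subI => //; apply: (leI _ _ _ Nj).
have sB : (size (f - h)%R <= d.+1)%N.
  by apply: leq_trans (size_polyD _ _) _; rewrite size_polyN geq_max sf sh.
rewrite ltnS; apply/leq_sizeP => i; rewrite leq_eqVlt => /predU1P[<-|di].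
  by rewrite coefB hE subrr.
by move/leq_sizeP: sB; apply.
Qed.
End Hilbert.

(** * Resolutions by matrices *)

Section LinearCombinations.
Variables (A : comNzRingType) (L : lmodType A).

Definition lc k (u : 'rV[A]_k) (e : 'I_k -> L) : L := \sum_i u 0 i *: e i.

Lemma lc0 k (e : 'I_k -> L) : lc 0 e = 0.
Proof. by rewrite /lc big1 // => i _; rewrite mxE scale0r. Qed.

Lemma lcD k (u v : 'rV[A]_k) (e : 'I_k -> L) : lc (u + v) e = lc u e + lc v e.
Proof. by rewrite -big_split; apply: eq_bigr => i _; rewrite mxE scalerDl. Qed.

Lemma lcZ k a (u : 'rV[A]_k) (e : 'I_k -> L) : lc (a *: u) e = a *: lc u e.
Proof. by rewrite scaler_sumr; apply: eq_bigr => i _; rewrite mxE scalerA. Qed.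

Lemma lcB k (u v : 'rV[A]_k) (e : 'I_k -> L) : lc (u - v) e = lc u e - lc v e.
Proof. by rewrite lcD -!scaleN1r lcZ. Qed.

Lemma lc_sum k I (r : seq I) (P : pred I) (F : I -> 'rV[A]_k) (e : 'I_k -> L) :
  lc (\sum_(i <- r | P i) F i) e = \sum_(i <- r | P i) lc (F i) e.
Proof. by apply: (big_morph (fun u => lc u e)) => [u v|]; rewrite ?lcD ?lc0. Qed.

Lemma lc_mulmx k l (u : 'rV[A]_k) (D : 'M[A]_(k, l)) (e : 'I_l -> L) :
  lc (u *m D) e = lc u (fun i => lc (row i D) e).
Proof.
rewrite mulmx_sum_row lc_sum; apply: eq_bigr => i _; exact: lcZ.
Qed.

Lemma lc_delta k (e : 'I_k -> L) i : lc (delta_mx 0 i) e = e i.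
Proof.
rewrite /lc (bigD1 i) //= big1 => [|j ji]; rewrite mxE !eqxx ?scale1r ?addr0 //.
by rewrite (negbTE ji) scale0r.
Qed.

Lemma lc_row_mx k l (u : 'rV[A]_k) (v : 'rV[A]_l) (e : 'I_k -> L) (f : 'I_l -> L) :
  lc (row_mx u v) (fun i => match split i with inl j => e j | inr j => f j end)
    = lc u e + lc v f.
Proof.
rewrite /lc big_split_ord /=; congr (_ + _); apply: eq_bigr => i _.
  by rewrite row_mxEl (unsplitK (inl i)).
by rewrite row_mxEr (unsplitK (inr i)).
Qed.

(** Submodules are Prop-valued subsets of an ambient module: the resolved
    modules arise as submodules, over a subring, of a given module, and no
    quotient or subtype has to be formed. *)
Definition spans (X : L -> Prop) k (e : 'I_k -> L) : Prop :=
  forall m, X m <-> exists u, m = lc u e.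

Definition fg_subset (X : L -> Prop) : Prop :=
  exists k (e : 'I_k -> L), spans X e.

Lemma spans_gen (X : L -> Prop) k (e : 'I_k -> L) i : spans X e -> X (e i).
Proof. by move=> Xe; apply/Xe; exists (delta_mx 0 i); rewrite lc_delta. Qed.

Lemma spans_submodule (X : L -> Prop) k (e : 'I_k -> L) : spans X e -> submodule X.
Proof.
move=> Xe; split; first by apply/Xe; exists 0; rewrite lc0.
  by move=> _ _ /Xe[u ->] /Xe[v ->]; apply/Xe; exists (u + v); rewrite lcD.
by move=> a _ /Xe[u ->]; apply/Xe; exists (a *: u); rewrite lcZ.
Qed.

(** Maps between free modules are matrices acting on the right of row vectors. *)
Definition exact_complex (r : nat -> nat) (d : forall i, 'M[A]_(r i.+1, r i)) : Prop :=
  forall i (u : 'rV_(r i.+1)), u *m d i = 0 <-> exists w, u = w *m d i.+1.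

Definition resolves (X : L -> Prop) (r : nat -> nat)
    (d : forall i, 'M[A]_(r i.+1, r i)) (e : 'I_(r 0) -> L) : Prop :=
  [/\ spans X e,
      forall u, lc u e = 0 <-> exists w, u = w *m d 0
    & exact_complex d].

Definition has_resolution (p : nat) (X : L -> Prop) : Prop :=
  exists (r : nat -> nat) (d : forall i, 'M[A]_(r i.+1, r i)) (e : 'I_(r 0) -> L),
    (forall i, (p <= i)%N -> r i = r p) /\ resolves X d e.
End LinearCombinations.

Definition resolvable (p : nat) (A : comNzRingType) : Prop :=
  forall (L : lmodType A) (X : L -> Prop), fg_subset X -> has_resolution p X.

Lemma complex_mul0 (A : comNzRingType) (r : nat -> nat)
    (d : forall i, 'M[A]_(r i.+1, r i)) i :
  exact_complex d -> d i.+1 *m d i = 0.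
Proof.
move=> ex; apply/row_matrixP => k; rewrite row_mul row0; apply/ex.
by exists (delta_mx 0 k); rewrite rowE.
Qed.

(** Over a principal ideal ring the kernel of any k x l matrix is the row space
    of a square matrix, so that no syzygy module needs more than k generators:
    the ranks are constant from degree 0 on. *)
Lemma PIR_resolvable (A : comNzRingType) : is_PIR A -> resolvable 0 A.
Proof.
move=> pirA L X [k [e Xe]].
have [D DP] : exists D : 'M[A]_k, forall u, lc u e = 0 <-> exists w, u = w *m D.
  apply: (@PIR_submodule_gen _ _ (fun u => lc u e = 0)) => //; split; first exact: lc0.
    by move=> u v u0 v0; rewrite lcD u0 v0 addr0.
  by move=> a u u0; rewrite lcZ u0 scaler0.
have [|next nextP] := @choice _ _ (fun E E' : 'M[A]_k =>
    forall u : 'rV_k, u *m E = 0 <-> exists w, u = w *m E').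
  move=> E; apply: (@PIR_submodule_gen _ _ (fun u => u *m E = 0)) => //.
  split; first exact: mul0mx.
    by move=> u v u0 v0; rewrite mulmxDl u0 v0 addr0.
  by move=> a u u0; rewrite -scalemxAl u0 scaler0.
exists (fun=> k), (fun i => iter i next D), e; by split=> //; split.
Qed.

(** The invariant [P] is what makes the next choice possible, [Q] what is
    wanted of two successive choices. *)
Lemma dependent_choice (T : nat -> Type) (P : forall i, T i -> Prop)
    (Q : forall i, T i -> T i.+1 -> Prop) (x0 : T 0%N) :
  P 0%N x0 -> (forall i x, P i x -> exists2 y, Q i x y & P i.+1 y) ->
  exists2 f : forall i, T i, f 0%N = x0 & forall i, Q i (f i) (f i.+1).
Proof.
move=> P0 step.
have next i (x : {x : T i | P i x}) :
    {y : {y : T i.+1 | P i.+1 y} | Q i (sval x) (sval y)}.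
  apply: cid; case: x => x Px; have [y Qxy Py] := step i x Px.
  by exists (exist _ y Py).
pose f := fix f i : {x : T i | P i x} :=
  if i is j.+1 then sval (next j (f j)) else exist _ x0 P0.
by exists (fun i => sval (f i)) => // i; apply: (svalP (next i (f i))).
Qed.

Lemma lift_rows (A : comNzRingType) k l m (M : 'M[A]_(k, m)) (D : 'M[A]_(l, m)) :
  (forall i, exists w, row i M = w *m D) -> exists W, M = W *m D.
Proof.
move=> /(@choice _ _ (fun i w => row i M = w *m D))[w wP].
by exists (\matrix_i w i); apply/row_matrixP => i; rewrite row_mul rowK.
Qed.

(** The comparison theorem: freeness of the source and exactness of the target
    allow one to choose each component of the lift from the previous one. *)
Lemma lift_linear (A : comNzRingType) (L1 L2 : lmodType A) (X1 : L1 -> Prop)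
    (X2 : L2 -> Prop) r1 (d1 : forall i, 'M[A]_(r1 i.+1, r1 i)) e1
    r2 (d2 : forall i, 'M[A]_(r2 i.+1, r2 i)) e2 (h : {linear L1 -> L2}) :
  resolves X1 d1 e1 -> resolves X2 d2 e2 -> (forall m, X1 m -> X2 (h m)) ->
  exists2 a : forall i, 'M[A]_(r1 i, r2 i),
    forall v, lc (v *m a 0%N) e2 = h (lc v e1)
  & forall i, a i.+1 *m d2 i = d1 i *m a i.
Proof.
move=> [X1e lc1 ex1] [X2e lc2 ex2] hX.
have [|w wE] := @choice _ _ (fun i w => h (e1 i) = lc w e2).
  by move=> i; apply/X2e/hX/(spans_gen _ X1e).
pose a0 : 'M[A]_(r1 0%N, r2 0%N) := \matrix_i w i.
have a0P v : lc (v *m a0) e2 = h (lc v e1).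
  rewrite lc_mulmx linear_sum; apply: eq_bigr => i _.
  by rewrite rowK linearZ wE.
(* A partial lift can be continued as soon as it maps boundaries to
   boundaries; this is the invariant of the construction. *)
have [||a a0E aE] := @dependent_choice (fun i => 'M[A]_(r1 i, r2 i))
  (fun i a => exists b, d1 i *m a = b *m d2 i)
  (fun i a b => b *m d2 i = d1 i *m a) a0; last by exists a; rewrite ?a0E.
  apply: lift_rows => i; apply/lc2; rewrite row_mul a0P.
  suff -> : lc (row i (d1 0%N)) e1 = 0 by rewrite linear0.
  by apply/lc1; exists (delta_mx 0 i); rewrite rowE.
move=> i a [b abE]; exists b => //; apply: lift_rows => j.
apply/ex2; rewrite -row_mul -mulmxA -abE mulmxA.
by rewrite complex_mul0 // mul0mx row0.
Qed.

(** * Mapping cones *)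

Section Cone.
Variables (A : comNzRingType) (r1 r2 : nat -> nat).
Variables (d1 : forall i, 'M[A]_(r1 i.+1, r1 i)) (d2 : forall i, 'M[A]_(r2 i.+1, r2 i)).
Variable f : forall i, 'M[A]_(r1 i, r2 i).

Definition cone_rank (i : nat) : nat :=
  if i is j.+1 then (r2 i + r1 j)%N else r2 0.

Definition cone_diff (i : nat) : 'M[A]_(cone_rank i.+1, cone_rank i) :=
  if i is j.+1 return 'M[A]_(cone_rank i.+1, cone_rank i)
  then block_mx (d2 j.+1) 0 (f j.+1) (- d1 j)
  else col_mx (d2 0) (f 0).

Hypothesis ex1 : exact_complex d1.
Hypothesis ex2 : exact_complex d2.
Hypothesis fE : forall i, f i.+1 *m d2 i = d1 i *m f i.
(* The map induced by f on the cokernels of d1 0 and d2 0 is injective. *)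
Hypothesis f_inj : forall v : 'rV_(r1 0%N), (exists w, v *m f 0%N = w *m d2 0%N) ->
  exists w, v = w *m d1 0%N.

Lemma cone_diff_mul0 i : cone_diff i.+1 *m cone_diff i = 0.
Proof.
have dd1 j := complex_mul0 j ex1; have dd2 j := complex_mul0 j ex2.
case: i => [|i] /=.
  rewrite mul_block_col mul0mx addr0 dd2 mulNmx fE subrr.
  exact: col_mx0.
rewrite mulmx_block !(mul0mx, mulmx0, addr0, add0r) dd2 !mulNmx mulmxN opprK fE.
by rewrite dd1 subrr block_mx0.
Qed.

(** This is the long exact sequence of the cone. In degree 1 the homology of the
    cone is the kernel of the map induced on cokernels, and in higher degrees
    it lies between homology modules of d1 and d2, which vanish. *)
Lemma cone_exact : exact_complex cone_diff.
Proof.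
have split_rV k l (u : 'rV[A]_(k + l)) : exists v w, u = row_mx v w.
  by exists (lsubmx u), (rsubmx u); rewrite hsubmxK.
move=> i u0; split=> [|[w0 ->]]; last by rewrite -mulmxA cone_diff_mul0 mulmx0.
case: i u0 => [|i] /= u0; have [u [v ->]] := split_rV _ _ u0.
  rewrite mul_row_col => uv0.
  have [w vE] : exists w, v = w *m d1 0%N.
    by apply: f_inj; exists (- u); rewrite mulNmx; apply/eqP; rewrite -addr_eq0 addrC uv0.
  have [z zE] : exists z, u + w *m f 1%N = z *m d2 1%N.
    by apply/ex2; rewrite mulmxDl -mulmxA fE mulmxA -vE.
  exists (row_mx z (- w)); rewrite mul_row_block -zE mulmx0 add0r mulNmx addrK.
  by rewrite mulmxN mulNmx opprK -vE.
rewrite mul_row_block mulmx0 add0r mulmxN => uv0.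
have [uE vE] : u *m d2 i.+1 + v *m f i.+1 = 0 /\ - (v *m d1 i) = 0.
  by apply: eq_row_mx; rewrite row_mx0.
have [w wE] : exists w, v = w *m d1 i.+1.
  by apply/ex1; apply/eqP; rewrite -oppr_eq0 vE.
have [z zE] : exists z, u + w *m f i.+2 = z *m d2 i.+2.
  by apply/ex2; rewrite mulmxDl -mulmxA fE mulmxA -wE.
exists (row_mx z (- w)); rewrite mul_row_block -zE mulmx0 add0r mulNmx addrK.
by rewrite mulmxN mulNmx opprK -wE.
Qed.
End Cone.

(** * Restriction of scalars and change of rings *)

(** A copy of the carrier of [L], on which a structure of [A]-module can be
    declared without competing with that of [L]. *)
Definition restr (A B : comNzRingType) (phi : {rmorphism A -> B})
  (L : lmodType B) : Type := L.

Section Restriction.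
Variables (A B : comNzRingType) (phi : {rmorphism A -> B}) (L : lmodType B).
Local Notation V := (restr phi L).

HB.instance Definition _ := GRing.Zmodule.on V.

Definition restr_scale (a : A) (x : V) : V := phi a *: (x : L).

Fact restr_scaleA a b x : restr_scale a (restr_scale b x) = restr_scale (a * b) x.
Proof. by rewrite /restr_scale scalerA rmorphM. Qed.
Fact restr_scale1 : left_id 1 restr_scale.
Proof. by move=> x; rewrite /restr_scale rmorph1 scale1r. Qed.
Fact restr_scaleDr : right_distributive restr_scale +%R.
Proof. by move=> a x y; apply: scalerDr. Qed.
Fact restr_scaleDl x : {morph restr_scale^~ x : a b / a + b}.
Proof. by move=> a b; rewrite /restr_scale rmorphD scalerDl. Qed.

HB.instance Definition _ := GRing.Zmodule_isLmodule.Build A V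
  restr_scaleA restr_scale1 restr_scaleDr restr_scaleDl.

Lemma lc_restr k (u : 'rV[A]_k) (e : 'I_k -> V) :
  lc u e = lc (map_mx phi u) (e : 'I_k -> L).
Proof. by apply: eq_bigr => i _; rewrite mxE. Qed.
End Restriction.

(** * Polynomial extension *)

Section CoefficientMatrices.
Variable A : comNzRingType.
Implicit Types (k l m : nat).

Definition coef_mx i k l (M : 'M[{poly A}]_(k, l)) : 'M[A]_(k, l) :=
  map_mx (coefp i) M.

Local Notation "M ^P" := (map_mx polyC M) (at level 2, format "M ^P").

Lemma coef_mxP k l (M N : 'M[{poly A}]_(k, l)) :
  (forall i, coef_mx i M = coef_mx i N) -> M = N.
Proof.
move=> eqMN; apply/matrixP => a b; apply/polyP => i.
by have /matrixP/(_ a b) := eqMN i; rewrite !mxE.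
Qed.

Lemma coef_mx0 i k l : coef_mx i (0 : 'M[{poly A}]_(k, l)) = 0.
Proof. by apply/matrixP => a b; rewrite !mxE /= coef0. Qed.

Lemma coef_mxB i k l (M N : 'M[{poly A}]_(k, l)) :
  coef_mx i (M - N) = coef_mx i M - coef_mx i N.
Proof. by apply/matrixP => a b; rewrite !mxE /= coefB. Qed.

Lemma coef_mxXn i n k l (M : 'M[A]_(k, l)) :
  coef_mx i ('X^n *: M^P) = if i == n then M else 0.
Proof.
apply/matrixP => a b; rewrite !mxE /= coefMC coefXn.
by case: eqP => _; rewrite ?mul1r ?mul0r ?mxE.
Qed.

Lemma coef_mxX i k l (M : 'M[{poly A}]_(k, l)) :
  coef_mx i.+1 ('X *: M) = coef_mx i M.
Proof. by apply/matrixP => a b; rewrite !mxE /= coefXM. Qed.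

Lemma coef_mxM i k l m (M : 'M[{poly A}]_(k, l)) (N : 'M[A]_(l, m)) :
  coef_mx i (M *m N^P) = coef_mx i M *m N.
Proof.
apply/matrixP => a b; rewrite !mxE /= coef_sum; apply: eq_bigr => c _.
by rewrite !mxE /= coefMC.
Qed.

Lemma coef_mx_bounded l (u : 'rV[{poly A}]_l) :
  exists D, forall i, (D <= i)%N -> coef_mx i u = 0.
Proof.
exists (\max_j size (u 0 j)%R) => i Di; apply/rowP => j; rewrite !mxE /=.
by apply: (leq_sizeP _ _ _ i (leqnn i)); apply: leq_trans Di; apply: leq_bigmax.
Qed.

(** A[X] is free over A on the powers of X, so that the row space of a matrix
    over A is extended coefficient by coefficient; this is the flatness used
    in extending resolutions. *)
Lemma row_space_poly l m (v : 'rV[{poly A}]_m) (M : 'M[A]_(l, m)) :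
  (exists w, v = w *m M^P) <-> forall i, exists w, coef_mx i v = w *m M.
Proof.
split=> [[w ->] i|]; first by exists (coef_mx i w); rewrite coef_mxM.
move=> /(@choice _ _ (fun i w => coef_mx i v = w *m M))[w wP].
have [D D0] := coef_mx_bounded v.
exists (\row_j \poly_(i < D) w i 0 j); apply: coef_mxP => i.
rewrite coef_mxM.
have [Di|iD] := leqP D i.
  rewrite D0 // [coef_mx i _](_ : _ = 0) ?mul0mx //.
  by apply/rowP => j; rewrite !mxE /= coef_poly ltnNge Di.
rewrite wP; congr (_ *m _); apply/rowP => j.
by rewrite !mxE /= coef_poly iD.
Qed.

Lemma exact_poly (r : nat -> nat) (d : forall i, 'M[A]_(r i.+1, r i)) :
  exact_complex d -> exact_complex (fun i => (d i)^P).
Proof.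
move=> ex i u; rewrite row_space_poly; split=> [ud0 j | uE].
  by apply/ex; rewrite -coef_mxM ud0 coef_mx0.
apply: coef_mxP => j; rewrite coef_mxM coef_mx0; exact/ex.
Qed.
End CoefficientMatrices.

Local Notation "M ^P" := (map_mx polyC M) (at level 2, format "M ^P").

Section PolyModule.
Variables (A : comNzRingType) (L : lmodType {poly A}).

Local Notation V := (restr (polyC : {rmorphism A -> {poly A}}) L).

Lemma lc_polyC k (u : 'rV[A]_k) (e : 'I_k -> V) : lc u^P (e : 'I_k -> L) = lc u e.
Proof. by rewrite -lc_restr. Qed.

Lemma lc_poly D k (u : 'rV[{poly A}]_k) (e : 'I_k -> L) :
  (forall i, (D <= i)%N -> coef_mx i u = 0) ->
  lc u e = \sum_(i < D) 'X^i *: (lc (coef_mx i u) (e : 'I_k -> V) : L).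
Proof.
move=> uD; have uE : u = \sum_(i < D) 'X^i *: (coef_mx i u)^P.
  apply: coef_mxP => i; rewrite [in RHS]/coef_mx raddf_sum /=.
  have [Di|iD] := leqP D i.
    rewrite uD // big1 // => j _; have := coef_mxXn i j (coef_mx j u).
    by rewrite /coef_mx => ->; rewrite gtn_eqF // (leq_trans _ Di).
  rewrite (bigD1 (Ordinal iD)) //= big1 => [|j ji].
    by have := coef_mxXn i i (coef_mx i u); rewrite /coef_mx eqxx addr0.
  have := coef_mxXn i j (coef_mx j u); rewrite /coef_mx => ->.
  by rewrite ifN // eq_sym.
by rewrite {1}uE lc_sum; apply: eq_bigr => i _; rewrite lcZ lc_polyC.
Qed.

Lemma scale_restrC (f : {poly A}) (a : A) (x : V) :
  f *: ((a *: x : V) : L) = a *: (f *: (x : L) : V).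
Proof.
change (f *: (a%:P *: (x : L)) = a%:P *: (f *: (x : L))).
by rewrite !scalerA mulrC.
Qed.

Definition mulX (x : V) : V := 'X *: (x : L).

Fact mulX_linear : linear mulX.
Proof.
by move=> a x y; rewrite /mulX scalerDr scale_restrC.
Qed.
HB.instance Definition _ := GRing.isLinear.Build A V V _ mulX mulX_linear.

(** Since X2 contains X1 and X X1, f (x) m |-> X f (x) m - f (x) X m defines a map
    from A[X] (x) X1 to A[X] (x) X2. It is always injective: a polynomial in its
    kernel has coefficients with c_i = X c_(i+1), and they vanish for large i.
    The last hypothesis says that the leading coefficient of an element of
    positive degree of the kernel of A[X] (x) X2 -> Y lies in X1. Then this
    element can be lowered in degree modulo the image of the map above, so that
    Y is the cokernel of this map and is resolved by its cone. *)
Lemma resolution_by_cone (p : nat) (X1 X2 : V -> Prop) (Y : L -> Prop) k (g : 'I_k -> L) :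
  has_resolution p X1 -> has_resolution p X2 ->
  (forall m, X1 m -> X2 m) -> (forall m, X1 m -> X2 (mulX m)) ->
  spans Y g -> (forall i, X2 (g i)) -> (forall m, X2 m -> Y m) ->
  (forall D (m : nat -> V), (forall i, X2 (m i)) ->
    \sum_(i < D.+2) 'X^i *: (m i : L) = 0 -> X1 (m D.+1)) ->
  has_resolution p.+1 Y.
Proof.
move=> [r1 [d1 [e1 [r1p res1]]]] [r2 [d2 [e2 [r2p res2]]]] X12 X1X Yg X2g X2Y top.
have [X1e lc1 ex1] := res1; have [X2e lc2 ex2] := res2.
have [a a0 aE] := lift_linear (h := idfun) res1 res2 X12.
have [b b0 bE] := lift_linear (h := mulX) res1 res2 X1X.
pose f i := 'X *: (a i)^P - (b i)^P.
have fE i : f i.+1 *m (d2 i)^P = (d1 i)^P *m f i.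
  rewrite mulmxBl mulmxBr -scalemxAl -scalemxAr -!map_mxM.
  by rewrite aE bE.
pose cone0 := cone_diff (fun i => (d1 i)^P) (fun i => (d2 i)^P) f 0.
have lc_d2 (u : 'rV_(r2 1%N)) : lc (u *m (d2 0%N)^P) (e2 : 'I_(r2 0%N) -> L) = 0.
  rewrite lc_mulmx /lc big1 // => i _; rewrite -/(lc _ _).
  rewrite -map_row lc_polyC; suff -> : lc (row i (d2 0%N)) e2 = 0 by rewrite scaler0.
  by apply/lc2; exists (delta_mx 0 i); rewrite rowE.
have lc_f (v : 'rV_(r1 0%N)) : lc (v *m f 0%N) (e2 : 'I_(r2 0%N) -> L) = 0.
  rewrite lc_mulmx /lc big1 // => i _; rewrite -/(lc _ _).
  rewrite linearB linearZ /= -!map_row lcB lcZ !lc_polyC !rowE a0 b0 /= lc_delta.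
  by rewrite subrr scaler0.
have f_inj (v : 'rV_(r1 0%N)) : (exists w, v *m f 0%N = w *m (d2 0%N)^P) ->
    exists w, v = w *m (d1 0%N)^P.
  move=> /row_space_poly vf; apply/row_space_poly => i; apply/lc1.
  have [D vD] := coef_mx_bounded v.
  have rec j : lc (coef_mx j v) e1 = mulX (lc (coef_mx j.+1 v) e1).
    have /lc2 := vf j.+1; rewrite mulmxBr coef_mxB -scalemxAr coef_mxX !coef_mxM.
    by rewrite lcB a0 b0 /= => /eqP; rewrite subr_eq0 => /eqP.
  have [Di|/ltnW] := leqP D i; first by rewrite vD // lc0.
  move/subnK; move: (D - i)%N => n; elim: n i => [i|n IHn i] Di.
    by rewrite vD ?lc0 // -Di.
  by rewrite rec IHn ?linear0 // addnS -addSn.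
have coker_cone (u : 'rV_(r2 0%N)) :
    lc u (e2 : 'I_(r2 0%N) -> L) = 0 <-> exists w, u = w *m cone0.
  split=> [|[w ->]]; last first.
    by rewrite -[w]hsubmxK mul_row_col lcD lc_d2 lc_f addr0.
  suff ind D : forall u : 'rV_(r2 0%N), (forall i, (D < i)%N -> coef_mx i u = 0) ->
      lc u (e2 : 'I_(r2 0%N) -> L) = 0 ->
      exists z v, u = z *m (d2 0%N)^P + v *m f 0%N.
    have [D uD] := coef_mx_bounded u.
    move=> /(ind D _)[i Di|z [v ->]]; first by rewrite uD // ltnW.
    by exists (row_mx z v); rewrite mul_row_col.
  elim: D => [|D IHD] {}u uD u0.
    have [z ->] : exists z, u = z *m (d2 0%N)^P.
      apply/row_space_poly => -[|i]; apply/lc2; last by rewrite uD // lc0.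
      by rewrite (@lc_poly 1) // big_ord1 expr0 scale1r in u0.
    by exists z, 0; rewrite mul0mx addr0.
  have [w wE] : exists w, lc (coef_mx D.+1 u) e2 = lc w e1.
    apply/X1e; apply: (top D (fun i => lc (coef_mx i u) e2)).
      by move=> i; apply/X2e; exists (coef_mx i u).
    by rewrite -lc_poly.
  (* The top coefficient of u is pushed down in degree by the image of w X^D,
     up to a boundary. *)
  pose v1 := 'X^D *: w^P.
  have [z0 z0E] : exists z, coef_mx D.+1 (u - v1 *m f 0%N) = z *m d2 0%N.
    apply/lc2; rewrite coef_mxB lcB wE mulmxBr coef_mxB -scalemxAr coef_mxX.
    rewrite !coef_mxM !coef_mxXn eqxx gtn_eqF // mul0mx subr0 a0.
    by rewrite subrr.
  pose z1 := 'X^(D.+1) *: z0^P.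
  have [i Di||z [v uE]] := IHD (u - v1 *m f 0%N - z1 *m (d2 0%N)^P).
  - rewrite coef_mxB coef_mxM coef_mxXn.
    have [->|iD] := eqVneq i D.+1; first by rewrite z0E subrr.
    have {iD Di} Di : (D.+1 < i)%N by rewrite ltn_neqAle eq_sym iD.
    case: i Di => // i Di.
    rewrite mul0mx subr0 coef_mxB uD // mulmxBr coef_mxB -scalemxAr coef_mxX.
    rewrite !coef_mxM !coef_mxXn (gtn_eqF (Di : (D < i)%N)).
    by rewrite (gtn_eqF (ltnW Di)) !mul0mx !subr0.
  - by rewrite !lcB u0 lc_f lc_d2 !subr0.
  exists (z + z1), (v + v1); rewrite !mulmxDl addrACA -uE.
  by rewrite addrCA addrA [_ *m _ + _]addrC !subrK.
exists (cone_rank r1 r2), (cone_diff (fun i => (d1 i)^P) (fun i => (d2 i)^P) f), e2.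
split.
  by case=> // i pi /=; rewrite [r2 i.+1]r2p ?(r1p i) ?[r2 p.+1]r2p // leqW.
split; last by apply: cone_exact; rewrite //; apply: exact_poly.
  move=> m; split=> [/Yg[u ->] | [u ->]]; last first.
    have [Y0 aY sY] := spans_submodule Yg.
    apply: submodule_sum => [|i _]; first exact: spans_submodule Yg.
    by apply/sY/X2Y/(spans_gen _ X2e).
  have [|w wE] := @choice _ _ (fun i w => g i = lc w e2).
    by move=> i; apply/X2e.
  exists (u *m (\matrix_i w i)^P); rewrite lc_mulmx; apply: eq_bigr => i _.
  by rewrite -map_row rowK lc_polyC wE.
exact: coker_cone.
Qed.

(** [deg_lt g j] consists of the values at [g] of the vectors of polynomials
    of degree less than j. *)
Fixpoint deg_lt k (g : 'I_k -> L) (j : nat) (m : V) : Prop :=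
  if j is i.+1 then
    exists t m', deg_lt g i m' /\ m = ('X^i *: (lc t (g : 'I_k -> V) : L) : V) + m'
  else m = 0.

Section Filtration.
Variables (k : nat) (g : 'I_k -> L).
Local Notation gV := (g : 'I_k -> V).

Lemma deg_lt_fg j : fg_subset (deg_lt g j).
Proof.
elim: j => [|j [l [e eE]]].
  exists 0%N, (fun=> 0) => m; split=> [->|[u ->]]; last exact: big_ord0.
  by exists 0; rewrite lc0.
exists (k + l)%N,
  (fun i => match split i with inl i => 'X^j *: g i | inr i => e i end) => m.
have scaleX (t : 'rV_k) : lc t (fun i => 'X^j *: g i : V) = 'X^j *: (lc t gV : L).
  rewrite scaler_sumr; apply: eq_bigr => i _.
  by rewrite scale_restrC.
split=> [[t [_ [/eE[u ->] ->]]]|[u ->]].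
  by exists (row_mx t u); rewrite lc_row_mx scaleX.
exists (lsubmx u), (lc (rsubmx u) e); split; first by apply/eE; exists (rsubmx u).
by rewrite -{1}[u]hsubmxK lc_row_mx scaleX.
Qed.

Lemma deg_lt_submodule j : submodule (deg_lt g j).
Proof. by have [l [e eE]] := deg_lt_fg j; apply: spans_submodule eE. Qed.

Lemma deg_lt_asc : ascending (deg_lt g).
Proof.
by move=> j m jm; exists 0, m; rewrite lc0 scaler0 add0r.
Qed.

Lemma deg_lt_mulX j m : deg_lt g j m -> deg_lt g j.+1 (mulX m).
Proof.
elim: j m => [_ ->|j IHj m [t [m' [jm' ->]]]].
  by apply: deg_lt_asc; rewrite linear0.
exists t, (mulX m'); split; first exact: IHj.
by rewrite linearD /= {1}/mulX scalerA exprS.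
Qed.

Lemma deg_lt_mulXn i j m : deg_lt g j m -> deg_lt g (i + j) ('X^i *: (m : L) : V).
Proof.
move=> jm; elim: i => [|i IHi]; first by rewrite expr0 scale1r.
by rewrite exprS -scalerA addSn; apply: deg_lt_mulX.
Qed.

(** The vectors t such that X^j (t . g) lies in [deg_lt g j] are the leading
    coefficients of the relations of degree j between the [g i]. They form a
    submodule of A^k that increases with j, hence is stationary from some N on.
    The sum of the X^i m_i is a relation of degree D+1+N whose leading
    coefficient t is that of m_(D+1) in degree N; thus t also is the leading
    coefficient of a relation of degree N, and X^N (t . g) lies in
    [deg_lt g N]. *)
Lemma relations_generated_in_low_degree :
  noetherian A ->
  exists N, forall D (m : nat -> V), (forall i, deg_lt g N.+1 (m i)) ->
    \sum_(i < D.+2) 'X^i *: (m i : L) = 0 -> deg_lt g N (m D.+1).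
Proof.
move=> noeA.
have le_deg := ascending_le deg_lt_asc.
have [|j t jt|N NP] := @noetherian_rV A k
    (fun j t => deg_lt g j ('X^j *: (lc t gV : L) : V)) noeA.
- move=> j; have [j0 jD jZ] := deg_lt_submodule j; split.
  + by rewrite lc0 scaler0.
  + by move=> t u jt ju; rewrite lcD scalerDr; apply: jD.
  by move=> a t jt; rewrite lcZ scale_restrC; apply: jZ.
- by rewrite exprS -scalerA; apply: deg_lt_mulX.
exists N => D m mN; have [t [m' [Nm' mE]]] := mN D.+1.
rewrite big_ord_recr /= => /eqP; rewrite addrC mE scalerDr -addrA addr_eq0 => /eqP sum0.
have [_ ND _] := deg_lt_submodule N; apply: ND => //.
apply: (NP (D.+1 + N)%N); rewrite exprD -scalerA sum0.
have subDN := deg_lt_submodule (D.+1 + N).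
have [sub0 subD _] := subDN.
rewrite -[- _]sub0r; apply: (submoduleB subDN sub0); apply: subD.
  exact: deg_lt_mulXn.
apply: (@submodule_sum A V _ _ _ _ _ subDN) => i _.
apply: (le_deg (i + N.+1)%N); last exact: deg_lt_mulXn.
by rewrite addnS -addSn leq_add2r.
Qed.

Lemma deg_lt_span j m : deg_lt g j m -> exists u, (m : L) = lc u g.
Proof.
elim: j m => [_ ->|j IHj m [t [m' [/IHj[u uE] ->]]]].
  by exists 0; rewrite lc0.
by exists ('X^j *: t^P + u); rewrite lcD lcZ lc_polyC -uE.
Qed.

Lemma deg_lt_gen j i : deg_lt g j.+1 (g i).
Proof.
apply: (ascending_le deg_lt_asc (ltn0Sn j)); exists (delta_mx 0 i), 0.
by rewrite lc_delta expr0 scale1r addr0.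
Qed.
End Filtration.
End PolyModule.

Lemma resolvable_poly (p : nat) (A : comNzRingType) :
  noetherian A -> resolvable p A -> resolvable p.+1 {poly A}.
Proof.
move=> noeA resA L Y [k [g Yg]].
have [N NP] := relations_generated_in_low_degree g noeA.
have resN j : has_resolution p (deg_lt g j) by apply/resA/deg_lt_fg.
apply: (resolution_by_cone (resN N) (resN N.+1) _ _ Yg _ _ NP).
- exact: deg_lt_asc.
- exact: deg_lt_mulX.
- exact: deg_lt_gen.
by move=> m /deg_lt_span[u ->]; apply/Yg; exists u.
Qed.

(** * Polynomials in several variables *)

Section Isomorphism.
Variables (A B : comNzRingType) (phi : {rmorphism A -> B}) (psi : B -> A).
Hypotheses (phiK : cancel phi psi) (psiK : cancel psi phi).

Lemma noetherian_iso : noetherian A -> noetherian B.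
Proof.
move=> noeA I idI aI.
have [j|j a|N NP] := noeA (fun j a => I j (phi a)); last first.
- by exists N => j x Ix; rewrite -[x]psiK; apply: (NP j); rewrite psiK.
- exact: aI.
case: (idI j) => I0 addI mulI; split; first by rewrite rmorph0.
  by move=> x y Ix Iy; rewrite rmorphD; apply: addI.
by move=> a x Ix; rewrite rmorphM; apply: mulI.
Qed.

Lemma resolvable_iso p : resolvable p A -> resolvable p B.
Proof.
move=> resA L X [k [g Xg]]; pose V := restr phi L.
have mapK l m (M : 'M[B]_(l, m)) : map_mx phi (map_mx psi M) = M.
  by apply/matrixP => i j; rewrite !mxE psiK.
have phi_inj l m : injective (map_mx phi : 'M[A]_(l, m) -> 'M[B]_(l, m)).
  by apply: (can_inj (g := map_mx psi)) => M; apply/matrixP => i j; rewrite !mxE phiK.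
have [|r [d [e [rp [Xe lcd ex]]]]] := resA V X.
  exists k, g => m; split=> [/Xg[u ->]|[u ->]].
    by exists (map_mx psi u); rewrite lc_restr mapK.
  by rewrite lc_restr; apply/Xg; exists (map_mx phi u).
exists r, (fun i => map_mx phi (d i)), e; split=> //; split=> [m|u|i u].
- split=> [/Xe[u ->]|[u ->]]; first by exists (map_mx phi u); rewrite lc_restr.
  by apply/Xe; exists (map_mx psi u); rewrite lc_restr mapK.
- rewrite -[u]mapK -lc_restr lcd; split=> [[w ->]|[w]].
    by exists (map_mx phi w); rewrite -map_mxM.
  by rewrite -[w]mapK -map_mxM => /phi_inj uE; exists (map_mx psi w).
rewrite -[u]mapK -map_mxM -(map_mx0 phi); split=> [/phi_inj/ex[w ->]|[w]].
  by exists (map_mx phi w); rewrite -map_mxM.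
rewrite -[w]mapK -map_mxM => /phi_inj uE; congr map_mx.
by apply/ex; exists (map_mx psi w).
Qed.
End Isomorphism.

Local Notation widen := (widen_ord (leqnSn _)).

Section MultivariatePolynomials.
Variable R : comNzRingType.

Lemma muniX n (m : 'X_{1..n.+1}) :
  muni 'X_[m] = 'X_[[multinom m (widen i) | i < n]] *: 'X^(m ord_max)
  :> {poly {mpoly R[n]}}.
Proof. by rewrite muniE msuppX big_seq1 mcoeffX eqxx scale1r. Qed.

(** The inverse of [muni]: the variable is sent to the last variable. *)
Definition multi n : {rmorphism {poly {mpoly R[n]}} -> {mpoly R[n.+1]}} :=
  horner_eval 'X_ord_max \o map_poly (@mwiden n R).

Lemma multiC n (c : {mpoly R[n]}) : multi n c%:P = mwiden c.
Proof. by rewrite /multi /= map_polyC /horner_eval hornerC. Qed.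

Lemma multi_X n : multi n 'X = 'X_ord_max :> {mpoly R[n.+1]}.
Proof. by rewrite /multi /= map_polyX /horner_eval hornerX. Qed.

Lemma muni_mwiden n (c : {mpoly R[n]}) : muni (mwiden c) = c%:P.
Proof.
elim/mpolyind: c => [|a m p _ _ IHp]; first by rewrite !raddf0.
rewrite mwidenD mwidenZ muniD muniZ IHp mwidenX muniX mnmwiden_ordmax expr0.
rewrite polyCD; congr (_ + _); rewrite -mul_mpolyC polyCM mul_polyC alg_polyC.
by congr (_ *: ('X_[_])%:P); apply/mnmP => i; rewrite mnmE mnmwiden_widen.
Qed.

Lemma multiK n : cancel (multi n) (@muni n R).
Proof.
elim/poly_ind => [|p c IHp]; first by rewrite !raddf0.
rewrite rmorphD rmorphM multiC multi_X.
rewrite muniD muniM IHp muni_mwiden.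
congr (_ * _ + _); rewrite muniX mnm1E eqxx expr1.
suff -> : [multinom (U_(ord_max) : 'X_{1..n.+1})%MM (widen i) | i < n] = 0%MM.
  by rewrite mpolyX0 scale1r.
apply/mnmP => i; rewrite mnmE mnm1E mnm0E; case: eqP => // /(congr1 val) /= ni.
by have := ltn_eqF (ltn_ord i); rewrite -ni eqxx.
Qed.

Lemma muniK n : cancel (@muni n R) (multi n).
Proof.
elim/mpolyind => [|a m p _ _ IHp]; first by rewrite !raddf0.
rewrite muniD muniZ rmorphD IHp muniX; congr (_ + _).
rewrite -!mul_polyC !rmorphM rmorphXn !multiC multi_X mwidenC mwidenX mul_mpolyC.
congr (_ *: _); rewrite mpolyXn -mpolyXD; congr 'X_[_]; apply/mnmP => i.
rewrite mnmDE mulmnE mnm1E.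
have [i0|ni] := ltnP i n.
  have -> : i = widen (Ordinal i0) by apply/val_inj.
  by rewrite mnmwiden_widen mnmE eqE /= (gtn_eqF i0) mul0n addn0.
have -> : i = ord_max by apply/val_inj/eqP; rewrite eqn_leq ni -ltnS ltn_ord.
by rewrite mnmwiden_ordmax eqxx mul1n.
Qed.

Lemma mpoly0K : cancel (mcoeff 0%MM) (@mpolyC 0 R).
Proof.
move=> p; apply/mpolyP => m; rewrite mcoeffC.
by have -> : m = 0%MM; [apply/mnmP => -[] | rewrite eqxx mulr1].
Qed.

(** The two properties are proved together because the induction step for the
    second uses the first. *)
Lemma mpoly_resolvable n :
  is_PIR R -> noetherian {mpoly R[n]} /\ resolvable n {mpoly R[n]}.
Proof.
move=> pirR; elim: n => [|n [noe res]].
  have polyCK : cancel (@mpolyC 0 R) (mcoeff 0%MM).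
    by move=> c; rewrite mcoeffC eqxx mulr1.
  split; first exact: (noetherian_iso mpoly0K (PIR_noetherian pirR)).
  exact: (resolvable_iso polyCK mpoly0K (PIR_resolvable pirR)).
split; first exact: (noetherian_iso (@muniK n) (noetherian_poly noe)).
exact: (resolvable_iso (@multiK n) (@muniK n) (resolvable_poly noe res)).
Qed.
End MultivariatePolynomials.

(** * Products of quotients of principal ideal domains *)

Lemma quot_by_PIR (A : idomainType) (N : A) (hN : N \isn't a GRing.unit) :
  is_PID A -> is_PIR (quot_by hN).
Proof.
move=> pidA I [I0 addI mulI]; pose Q := {ideal_quot (pideal hN)}.
have [|g gP] := pidA (fun a => I (\pi_Q a)%qT).
  split; first by rewrite rmorph0.
    by move=> x y Ix Iy; rewrite rmorphD; apply: addI.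
  by move=> a x Ix; rewrite rmorphM; apply: mulI.
exists (\pi_Q g)%qT => x.
split=> [Ix|[a ->]]; last by rewrite mulrC; apply/mulI/gP; exists 1; rewrite mulr1.
have [a aE] : exists a, repr (x : Q) = g * a.
  by apply/gP; rewrite (reprK (x : Q)).
exists (\pi_Q a)%qT; rewrite -[LHS](reprK (x : Q)) aE; exact: rmorphM.
Qed.

Section Product.
Variables (q : nat) (T : 'I_q.+1 -> comNzRingType).

Definition prod_single i (a : T i) : prod_ring T :=
  [ffun j => dfwith (fun k => 0 : T k) a j].

Lemma prod_coord_sum (I : Type) (r : seq I) (F : I -> prod_ring T) j :
  (\sum_(i <- r) F i) j = \sum_(i <- r) F i j.
Proof. by apply: (big_morph (fun x : prod_ring T => x j)) => [x y|]; rewrite ffunE. Qed.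

(** An ideal of the product contains, with x, the components of x (its products
    with the idempotents), so it is generated by the element whose components
    generate its projections. *)
Lemma prod_PIR : (forall i, is_PIR (T i)) -> is_PIR (prod_ring T).
Proof.
move=> pirT I [I0 addI mulI].
have coordP i : exists x : prod_ring T, I x /\
    forall y, I y -> exists a, y i = x i * a.
  have [|g gP] := pirT i (fun a => exists2 x, I x & x i = a).
    split; first by exists 0; rewrite ?ffunE.
      by move=> _ _ [x Ix <-] [y Iy <-]; exists (x + y); rewrite ?ffunE //; apply: addI.
    move=> a _ [x Ix <-]; exists (prod_single a * x); first exact: mulI.
    by rewrite !ffunE dfwith_in.
  have [x Ix xE] : exists2 x, I x & x i = g by apply/gP; exists 1; rewrite mulr1.
  by exists x; split=> // y Iy; rewrite xE; apply/gP; exists y.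
have [x xP] := choice coordP.
pose g : prod_ring T := \sum_i prod_single (1 : T i) * x i.
have gE j : g j = x j j.
  rewrite prod_coord_sum (bigD1 j) //= big1 => [|i ij]; rewrite !ffunE.
    by rewrite dfwith_in mul1r addr0.
  by rewrite dfwith_out ?mul0r.
have Ig : I g by apply: big_ind => // i _; apply: mulI; case: (xP i).
exists g => y; split=> [Iy|[a ->]]; last by rewrite mulrC; apply: mulI.
have yP i : exists a : T i, y i = x i i * a by case: (xP i) => _; apply.
exists [ffun i => projT1 (cid (yP i))]; apply/ffunP => i.
by rewrite !ffunE gE; case: (cid (yP i)).
Qed.
End Product.

Theorem theorem6p5 (q : nat) (A : 'I_q.+1 -> idomainType)
    (hA : forall i, is_PID (A i))
    (N : forall i, A i) (hN : forall i, N i \isn't a GRing.unit)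
    (n : nat)
    (R := prod_ring (fun i => quot_by (hN i)))
    (S := {mpoly R[n]})
    (M : lmodType S) (hM : finitely_generated M) :
  exists (p : nat) (F : nat -> vectType S)
         (d : forall i, {linear stationary_from p F i.+1 -> stationary_from p F i})
         (eps : {linear stationary_from p F 0%N -> M}),
    (p <= n.+1)%N /\ is_resolution d eps.
Proof.
have pirR : is_PIR R by apply: prod_PIR => i; apply: quot_by_PIR.
have [_ resS] := mpoly_resolvable n pirR.
have [|r [d [e [rn res]]]] := resS M (fun=> True).
  have [k [g gP]] := hM; exists k, g => m; split=> // _.
  have [c ->] := gP m; exists (\row_i c i).
  by apply: eq_bigr => i _; rewrite mxE.
(* As r is constant from n on, it has the form required by stationary_from
   up to equality of functions, so that no cast of matrices is needed. *)
have [s sE] : exists s, r = fun i => s (minn i n).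
  exists r; apply/funext => i; rewrite /minn; case: ltnP => // ni; exact: rn.
subst r; have [Xe lcd ex] := res.
have lc_linear : linear (fun u : 'rV[S]_(s (minn 0 n)) => lc u e).
  by move=> a u v; rewrite lcD lcZ.
pose eps : {linear 'rV[S]_(s (minn 0 n)) -> M} :=
  HB.pack (fun u : 'rV[S]_(s (minn 0 n)) => lc u e)
    (GRing.isLinear.Build _ _ _ _ _ lc_linear).
exists n, (fun i => 'rV[S]_(s i) : vectType S), (fun i => mulmxr (d i)), eps.
split=> //; split.
- by move=> m; have [u ->] := (Xe m).1 I; exists u.
- move=> u; split=> [/lcd[w ->]|[w <-]]; first by exists w.
  by apply/lcd; exists w.
move=> i u; split=> [/ex[w ->]|[w <-]]; first by exists w.
by apply/ex; exists w.
Qed.
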